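(* Let $a\ge 0$, $0<\alpha\le 1$ and $0<\beta\le 1$ be real numbers, and consider Kakwani's functional form $$L(p;a,\alpha,\beta)=p-a\,p^{\alpha}(1-p)^{\beta},\qquad 0\le p\le 1 .$$ Then $p\mapsto L(p;a,\alpha,\beta)$ is a genuine Lorenz curve only if $\alpha=1$, $0\le a\le 1$ and $0<\beta\le 1$, which leads to the curve $$L_0(p)=p-a\,p\,(1-p)^{\beta},\qquad 0\le p\le 1 .$$
   Context: A function $L$ that is defined and continuous on $[0,1]$ with second derivative $L''(p)$ is a (genuine) Lorenz curve if and only if $$L(0)=0,\qquad L(1)=1,\qquad L'(0^+)\ge 0,\qquad L''(p)\ge 0\ \text{ for } p\in(0,1),$$ where $L'(0^+)=\lim_{p\to 0^+}L'(p)$; if this limit is $-\infty$, the condition $L'(0^+)\ge 0$ is not satisfied.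
   Formalization: The conclusion α = 1 is stated only for a ≠ 0, because for a = 0 the curve is L(p) = p, a genuine Lorenz curve for every α; the other conclusions, including L = L_0 on [0,1], are kept for all a ≥ 0. *)

(* Defs.v *)
From HB Require Import structures.
From mathcomp Require Import all_boot all_order all_algebra.
From mathcomp Require Import all_classical all_reals all_analysis.

Set Implicit Arguments.
Unset Strict Implicit.
Unset Printing Implicit Defensive.

Import Order.TTheory GRing.Theory Num.Theory.
Import numFieldNormedType.Exports.

Local Open Scope classical_set_scope.
Local Open Scope ring_scope.

(* Lorenz curves are functions on [0, 1]; they are represented by total
   functions on R, whose values outside [0, 1] play no role below: continuity
   is relative to [0, 1] and derivatives are only used inside ]0, 1[.
   The right limit L'(0+) is taken in the extended reals, so that it may be
   infinite; the value -oo is excluded by 0 <= l. *)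
Definition genuine_lorenz_curve (R : realType) (L : R -> R) : Prop :=
  [/\ {within `[0, 1], continuous L},
      forall p : R, 0 < p < 1 ->
        derivable L p 1 /\ derivable (L^`())%classic p 1,
      L 0 = 0 /\ L 1 = 1,
      exists2 l : \bar R,
        ((L^`())%classic p)%:E @[p --> 0^'+] --> l & (0 <= l)%E
    & forall p : R, 0 < p < 1 -> 0 <= (L^`(2))%classic p].

(* Here 0 `^ r = 0 for r != 0, so the values at p = 0 and p = 1 are the
   usual ones for positive exponents. *)
Definition kakwani (R : realType) (a alpha beta : R) (p : R) : R :=
  p - a * p `^ alpha * (1 - p) `^ beta.

Definition kakwani0 (R : realType) (a beta : R) (p : R) : R :=
  p - a * p * (1 - p) `^ beta.

(* Main.v *)
(* Since L(0) = 0, the mean value theorem gives L(p) = p L'(c) with 0 < c < p,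
   so L'(0+) >= 0 forces L(p) >= - e p for small p, for every e > 0. For
   Kakwani's form, where (1 - p)^beta >= 1 - p, this reads
   a p^alpha (1 - p) <= (1 + e) p. As p -> 0, it fails for a > 0 and alpha < 1,
   and it yields a <= 1 for alpha = 1. *)
Require Import Defs.
From HB Require Import structures.
From mathcomp Require Import all_boot all_order all_algebra.
From mathcomp Require Import all_classical all_reals all_analysis.
From mathcomp Require Import lra.

Import Order.TTheory GRing.Theory Num.Theory.
Import numFieldNormedType.Exports.

Local Open Scope classical_set_scope.
Local Open Scope ring_scope.

Lemma genuine_lorenz_curve_near0 (R : realType) (L : R -> R) (e : R) :
  genuine_lorenz_curve L -> 0 < e -> \forall p \near 0^'+, - e * p <= L p.
Proof.
move=> [cL dL [L0 _] [l Ll l0] _] e0.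
(* The open ray above -e in the extended reals contains [l], be it finite or +oo, so both cases are
   treated at once. *)
have : \forall p \near 0^'+, ((- e)%:E < ((L^`())%classic p)%:E)%E.
  apply: (Ll [set y | ((- e)%:E < y)%E]); apply: open_nbhs_nbhs; split.
    exact: open_ereal_gt_ereal.
  by rewrite /= (lt_le_trans _ l0) // lte_fin oppr_lt0.
(* On ]0, d[ the derivative exceeds -e; taking p < d puts the mean value point c there. *)
move=> [d /= d0 dP]; near=> p.
have p0 : 0 < p by [].
have p1 : p < 1 by near: p; apply: nbhs_right_lt.
have pd : p < d by near: p; apply: nbhs_right_lt.
have [||c] := @MVT R L (L^`())%classic 0 p p0.
- move=> x; rewrite in_itv /= => /andP[x0 xp].
  rewrite derive1E; apply: derivableP.
  by apply: (dL x _).1; rewrite x0 (lt_trans xp).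
- apply: continuous_subspaceW cL => x /=; rewrite !in_itv /= => /andP[-> xp].
  by rewrite (le_trans xp) // ltW.
rewrite in_itv /= L0 !subr0 => /andP[c0 cp] ->.
rewrite ler_pM2r // ltW // -lte_fin; apply: dP => //=.
by rewrite sub0r normrN gtr0_norm // (lt_trans cp).
Unshelve. all: by end_near. Qed.

Lemma kakwani_near0 (R : realType) (a alpha beta e : R) :
  0 <= a -> beta <= 1 -> genuine_lorenz_curve (kakwani a alpha beta) -> 0 < e ->
  \forall p \near 0^'+, a * p `^ alpha * (1 - p) <= (1 + e) * p.
Proof.
move=> a0 b1 gL e0; have Lge := genuine_lorenz_curve_near0 _ _ _ gL e0; near=> p.
have p0 : 0 < p by [].
have p1 : p < 1 by near: p; apply: nbhs_right_lt.
have : - e * p <= kakwani a alpha beta p by near: p.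
(* For a base in ]0, 1], powers decrease as the exponent grows. *)
have : 1 - p <= (1 - p) `^ beta.
  rewrite -[leLHS]powRr1 ?subr_ge0 ?(ltW p1)//.
  by apply: ger_powR => //; rewrite subr_gt0 p1 lerBlDr lerDl ltW.
move=> /(ler_wpM2l (mulr_ge0 a0 (powR_ge0 p alpha))).
rewrite /kakwani; lra.
Unshelve. all: by end_near. Qed.

(** Taking e = 1 and dividing by p^alpha gives a (1 - p) <= 2 p^(1 - alpha) near 0. If alpha < 1,
    the right side tends to 0 and the left side to a > 0. *)
Lemma kakwani_genuine_alpha (R : realType) (a alpha beta : R) :
  0 < a -> alpha <= 1 -> beta <= 1 ->
  genuine_lorenz_curve (kakwani a alpha beta) -> alpha = 1.
Proof.
move=> a0 al1 b1 gL; apply/eqP; rewrite eq_le al1 leNgt; apply/negP => lt_al1.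
have kle := kakwani_near0 _ _ _ _ _ (ltW a0) b1 gL ltr01.
have s0 : 0 < 1 - alpha by rewrite subr_gt0.
(* Chosen so that q^(1 - alpha) = a / 8: for p <= q, 2 p^(1 - alpha) is at most a / 4, while p < 1/2
   keeps a (1 - p) above a / 2. *)
pose q := (a / 8) `^ (1 - alpha)^-1.
have q0 : 0 < q by rewrite powR_gt0 // divr_gt0.
near (0 : R)^'+ => p.
have p0 : 0 < p by [].
have p2 : p < 1 / 2 by near: p; apply: nbhs_right_lt; lra.
have pq : p <= q by near: p; apply: nbhs_right_ltW.
have k : a * p `^ alpha * (1 - p) <= (1 + 1) * p by near: p.
have pE : p `^ alpha * p `^ (1 - alpha) = p.
  rewrite -powRD; first by rewrite addrC subrK powRr1 // ltW.
  by rewrite addrC subrK oner_eq0.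
have ps : p `^ (1 - alpha) <= a / 8.
  have <- : q `^ (1 - alpha) = a / 8.
    by rewrite -powRrM mulVf ?gt_eqF // powRr1 // ltW // divr_gt0.
  by apply: ge0_ler_powR; rewrite ?nnegrE ltW.
have pa0 := powR_gt0 alpha p0.
rewrite -{3}pE in k; move: k; set u := p `^ alpha in pa0 *.
move: ps; set v := p `^ (1 - alpha) => ps k.
have : a * (1 - p) <= 2 * v by rewrite -(ler_pM2l pa0); lra.
by have := mulr_gt0 a0 (_ : 0 < 1 / 2 - p); rewrite subr_gt0 => /(_ p2); lra.
Unshelve. all: by end_near. Qed.

Lemma kakwani1_genuine_le1 (R : realType) (a beta : R) :
  0 <= a -> beta <= 1 -> genuine_lorenz_curve (kakwani a 1 beta) -> a <= 1.
Proof.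
move=> a0 b1 gL; rewrite leNgt; apply/negP => a1.
(* With this e, 1 + e is the midpoint of 1 and a, hence below the limit a of a (1 - p). *)
have e0 : 0 < (a - 1) / 2 by lra.
have kle := kakwani_near0 _ _ _ _ _ a0 b1 gL e0.
near (0 : R)^'+ => p.
have p0 : 0 < p by [].
have k : a * p `^ 1 * (1 - p) <= (1 + (a - 1) / 2) * p by near: p.
(* Equivalent to a (1 - p) > (a + 1) / 2 = 1 + e, which contradicts [k] divided by p. *)
have : p < (a - 1) / 2 / a.
  by near: p; apply: nbhs_right_lt; rewrite divr_gt0 // (lt_trans ltr01).
rewrite ltr_pdivlMr ?(lt_trans ltr01)// => pa.
have : a * (1 - p) <= 1 + (a - 1) / 2.
  by rewrite -(ler_pM2r p0); move: k; rewrite powRr1 ?(ltW p0) //; lra.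
lra.
Unshelve. all: by end_near. Qed.

(* For a = 0 the curve p |-> p does not depend on alpha, so alpha = 1 can only
   be concluded when a != 0; the resulting curve is kakwani0 in all cases. *)
Theorem theorem2p2 (R : realType) (a alpha beta : R)
    (ha : 0 <= a) (halpha : 0 < alpha <= 1) (hbeta : 0 < beta <= 1) :
  genuine_lorenz_curve (kakwani a alpha beta) ->
  [/\ a != 0 -> alpha = 1,
      0 <= a <= 1,
      0 < beta <= 1
    & forall p : R, 0 <= p <= 1 -> kakwani a alpha beta p = kakwani0 a beta p].
Proof.
move=> gL; have [al1 b1] := (proj2 (andP halpha), proj2 (andP hbeta)).
have [a0|an0] := eqVneq a 0.
  by rewrite a0 lexx ler01; split=> // p _; rewrite /kakwani /kakwani0 !mul0r.
have alE : alpha = 1.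
  by apply: kakwani_genuine_alpha gL => //; rewrite lt_def an0.
rewrite alE in gL *; rewrite ha (kakwani1_genuine_le1 _ _ _ ha b1 gL).
by split=> // p /andP[p0 _]; rewrite /kakwani /kakwani0 powRr1.
Qed.
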